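(* Let $E,F$ be Banach spaces, let $X$ be a standard sequence class, let $\{Y_\lambda\}_{\lambda\in\Lambda}$ ($\Lambda\neq\emptyset$) be an $F$-nested family of standard sequence classes, and let $f:E\to F$ be a map that is linearly compatible with $Y_\lambda$ for every $\lambda\in\Lambda$. Suppose that the triple $(X,f,\{Y_\lambda\}_{\lambda\in\Lambda})$ is detachable and that the set $$G(X,f,\{Y_\lambda\}_{\lambda\in\Lambda})=\Big\{(x_j)_{j=1}^\infty\in X(E): (f(x_j))_{j=1}^\infty\notin\bigcup_{\lambda\in\Lambda}Y_\lambda(F)\Big\}$$ is non-empty. Then, for a cardinal number $\alpha\le\mathfrak c$, the set $G(X,f,\{Y_\lambda\}_{\lambda\in\Lambda})$ is $(\alpha,\mathfrak c)$-spaceable (as a subset of $X(E)$) if and only if $\alpha<\aleph_0$.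
   Context: Banach spaces are over $\mathbb K=\mathbb R$ or $\mathbb C$. The Continuum Hypothesis is assumed; $\aleph_0$ and $\mathfrak c$ are the cardinalities of $\mathbb N$ and $\mathbb R$. Standard sequence class: a rule $X$ assigning to each Banach space $E$ a (quasi-)Banach space $X(E)$ of $E$-valued sequences (with coordinatewise operations) such that: (i) there is a constant $C>0$ with $c_{00}(E)\subseteq X(E)\subseteq\ell_\infty(E)$ and $\|\cdot\|_{\ell_\infty(E)}\le C\|\cdot\|_{X(E)}$ on $X(E)$, where $c_{00}(E)$ is the space of eventually null and $\ell_\infty(E)$ the space of bounded $E$-valued sequences; (ii) if $x=(x_j)_j\in X(E)$ and $(x_{n_k})_k$ is a subsequence, then $(x_{n_k})_k\in X(E)$ and $\|(x_{n_k})_k\|_{X(E)}\le\|x\|_{X(E)}$; (iii) if $x=(x_j)_j\in X(E)$ and $n_1<n_2<\cdots$ are natural numbers, then the sequence $y$ having $x_i$ in coordinate $n_i$ for every $i$ and $0$ in all other coordinates belongs to $X(E)$ and $\|y\|_{X(E)}\le\|x\|_{X(E)}$. $F$-nested: for all $\lambda_1,\lambda_2\in\Lambda$, $Y_{\lambda_1}(F)\subseteq Y_{\lambda_2}(F)$ or $Y_{\lambda_2}(F)\subseteq Y_{\lambda_1}(F)$. Linearly compatible: a map $f:E\to F$ with $f(0)=0$ is linearly compatible with a standard sequence class $Y$ if for all $(x_j)_j,(y_j)_j\in E^{\mathbb N}$ and $a\in\mathbb K\setminus\{0\}$: $(f(x_j))_j\notin Y(F)$ implies $(f(ax_j))_j\notin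 Y(F)$; and $(f(x_j))_j,(f(y_j))_j\in Y(F)$ implies $(f(x_j+y_j))_j\in Y(F)$. Detachable: for a single class $Y$, put $G(X,f,Y)=\{(x_j)_j\in X(E):(f(x_j))_j\notin Y(F)\}$. A sequence $(x_j)_j\in G(X,f,Y)$ is detachable if there is an infinite set $\mathbb N_1\subset\mathbb N$ with infinite complement such that $(f(x_n))_{n\in\mathbb N_1}\in Y(F)$ (indexed in increasing order). The triple $(X,f,Y)$ is detachable if all elements of $G(X,f,Y)$ are detachable; $(X,f,\{Y_\lambda\}_{\lambda\in\Lambda})$ is detachable if $(X,f,Y_\lambda)$ is detachable for every $\lambda\in\Lambda$. $(\alpha,\beta)$-spaceable: for cardinals $\alpha\le\beta$ and a topological vector space $V$, a set $A\subset V$ is $(\alpha,\beta)$-spaceable if $A\cup\{0\}$ contains an $\alpha$-dimensional linear subspace of $V$ and, for every $\alpha$-dimensional subspace $U_\alpha\subset A\cup\{0\}$, there is a closed $\beta$-dimensional subspace $U_\beta$ of $V$ with $U_\alpha\subset U_\beta\subset A\cup\{0\}$. Dimension means algebraic (Hamel) dimension. *)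

(* Defs.v *)
From HB Require Import structures.
From mathcomp Require Export all_boot all_order all_algebra.
From mathcomp Require Export complex.
From mathcomp Require Export all_classical all_reals topology normedtype.
Export numFieldNormedType.Exports.

Set Implicit Arguments.
Unset Strict Implicit.
Unset Printing Implicit Defensive.

Import Order.TTheory GRing.Theory Num.Theory.

Local Open Scope classical_set_scope.
Local Open Scope ring_scope.

(* A cardinal is represented by any set (or type [I], through [[set: I]]) of
   that cardinality; the library provides [#<=] and [#=]. *)
Definition card_lt (T U : Type) (A : set T) (B : set U) : Prop :=
  (A #<= B)%card /\ ~ (A #= B)%card.

Definition continuum_hypothesis (R : realType) : Prop :=
  forall A : set R, ~ (card_lt [set: nat] A /\ card_lt A [set: R]).

Definition real_or_complex (R : realType) (K : numFieldType) : Prop :=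
  K = (R : numFieldType) \/ K = (R[i] : numFieldType).

(* As for norms in the library, the quasi-norm takes its values in the
   nonnegative (hence real) elements of the scalar field. The balls of a
   quasi-norm need not be open: they are only a base of neighbourhoods. *)
HB.mixin Record TopologicalLmodule_isQuasiBanach (K : numFieldType) V
    & TopologicalLmodule K V := {
  qnorm : V -> K ;
  qnorm_ge0 : forall x, 0 <= qnorm x ;
  qnorm0_eq0 : forall x, qnorm x = 0 -> x = 0 ;
  qnormZ : forall a x, qnorm (a *: x) = `|a| * qnorm x ;
  qnormD : exists2 C : K, 1 <= C &
    forall x y, qnorm (x + y) <= C * (qnorm x + qnorm y) ;
  nbhs_qnorm : forall (x : V) (A : set V),
    nbhs x A <-> exists2 e : K, 0 < e & [set y | qnorm (y - x) < e] `<=` A ;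
  qnorm_complete : forall u : nat -> V,
    (forall e : K, 0 < e -> exists N : nat, forall m n : nat,
       (N <= m)%N -> (N <= n)%N -> qnorm (u m - u n) < e) ->
    exists l : V, u @ \oo --> l
}.

#[short(type="quasiBanachType")]
HB.structure Definition QuasiBanach (K : numFieldType) :=
  {V of TopologicalLmodule K V & TopologicalLmodule_isQuasiBanach K V}.

Definition strictly_increasing (n : nat -> nat) : Prop :=
  {homo n : i j / (i < j)%N}.

Definition c00 (K : numFieldType) (E : normedModType K) : set (nat -> E) :=
  [set s | exists N : nat, forall j : nat, (N <= j)%N -> s j = 0].
Arguments c00 {K} E _.

(* [X E] is an abstract quasi-Banach space, identified with a space of
   [E]-valued sequences by the injective map [coord]; linearity of [coord] says
   that the operations are coordinatewise. The bound in [coord_le] says both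
   that the sequence is bounded and that its supremum norm is at most
   [C * qnorm x]. *)
Record std_seq_class (K : numFieldType) := StdSeqClass {
  seq_space :> forall E : completeNormedModType K, quasiBanachType K ;
  coord : forall E : completeNormedModType K,
    {linear seq_space E -> (nat -> E)} ;
  coord_inj : forall E : completeNormedModType K, injective (coord E) ;
  c00_sub : forall E : completeNormedModType K, c00 E `<=` range (coord E) ;
  coord_le : forall E : completeNormedModType K, exists2 C : K, 0 < C &
    forall (x : seq_space E) (j : nat), `|coord E x j| <= C * qnorm x ;
  subseq_closed : forall (E : completeNormedModType K) (x : seq_space E)
      (n : nat -> nat), strictly_increasing n ->
    exists2 y : seq_space E, forall k, coord E y k = coord E x (n k) &
      qnorm y <= qnorm x ;
  spread_closed : forall (E : completeNormedModType K) (x : seq_space E)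
      (n : nat -> nat), strictly_increasing n ->
    exists2 y : seq_space E,
      (forall i, coord E y (n i) = coord E x i) /\
      (forall j, ~ range n j -> coord E y j = 0) &
      qnorm y <= qnorm x
}.

Definition seqs (K : numFieldType) (X : std_seq_class K)
    (E : completeNormedModType K) : set (nat -> E) := range (coord X E).
Arguments seqs {K} X E _.

Definition nested (K : numFieldType) (F : completeNormedModType K)
    (L : Type) (Y : L -> std_seq_class K) : Prop :=
  forall l1 l2 : L,
    seqs (Y l1) F `<=` seqs (Y l2) F \/ seqs (Y l2) F `<=` seqs (Y l1) F.

Definition linearly_compatible (K : numFieldType)
    (E F : completeNormedModType K) (f : E -> F) (Y : std_seq_class K) : Prop :=
  [/\ f 0 = 0,
      forall (x : nat -> E) (a : K), a != 0 ->
        ~ seqs Y F (fun j => f (x j)) -> ~ seqs Y F (fun j => f (a *: x j)) &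
      forall x y : nat -> E,
        seqs Y F (fun j => f (x j)) -> seqs Y F (fun j => f (y j)) ->
        seqs Y F (fun j => f (x j + y j))].

(* [S] is [Y(F)] for a single class, and the union of the [Y_l(F)] for a
   family. *)
Definition G_set (K : numFieldType) (X : std_seq_class K)
    (E F : completeNormedModType K) (f : E -> F) (S : set (nat -> F)) :
    set (X E) :=
  [set x | ~ S (fun j => f (coord X E x j))].
Arguments G_set {K} X {E F} f S _.

Definition detachable_seq (K : numFieldType) (E F : completeNormedModType K)
    (f : E -> F) (Y : std_seq_class K) (x : nat -> E) : Prop :=
  exists (N1 : set nat) (n : nat -> nat),
    [/\ infinite_set N1, infinite_set (~` N1),
        strictly_increasing n, range n = N1 &
        seqs Y F (fun k => f (x (n k)))].

Definition detachable (K : numFieldType) (X : std_seq_class K)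
    (E F : completeNormedModType K) (f : E -> F) (Y : std_seq_class K) : Prop :=
  forall x : X E, G_set X f (seqs Y F) x -> detachable_seq f Y (coord X E x).

Section Dimension.
Variables (K : numFieldType) (V : lmodType K).

Definition lin_span (B : set V) : set V :=
  [set x | exists (s : seq V) (a : V -> K),
    [set` s] `<=` B /\ x = \sum_(v <- s) a v *: v].

Definition lin_indep (B : set V) : Prop :=
  forall (s : seq V) (a : V -> K), uniq s -> [set` s] `<=` B ->
    \sum_(v <- s) a v *: v = 0 -> forall v, v \in s -> a v = 0.

(* [U] is a linear subspace with a Hamel basis of cardinality [I]. *)
Definition subspace_of_dim (I : Type) (U : set V) : Prop :=
  exists B : set V,
    [/\ lin_indep B, lin_span B = U & (B #= [set: I])%card].

End Dimension.

Definition spaceable (K : numFieldType) (V : topologicalLmodType K)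
    (I J : Type) (A : set V) : Prop :=
  (exists U : set V, subspace_of_dim I U /\ U `<=` A `|` [set 0]) /\
  (forall U : set V, subspace_of_dim I U -> U `<=` A `|` [set 0] ->
     exists W : set V,
       [/\ closed W, subspace_of_dim J W, U `<=` W & W `<=` A `|` [set 0]]).

(* Main.v *)
(* Write [S] for the set of sequences [s] in [E] whose image [f o s] lies in
   some [Y_l(F)]. Linear compatibility and nestedness make [S] a linear
   subspace of all [E]-valued sequences, stable under subsequences, and
   [G = X(E) \ S].

   Let [U] be finite-dimensional with [U] meeting [S] only in [0]. Detaching
   the basis vectors of [U] one after the other gives an infinite set of
   indices along which all of [U] lies in [S]; split it into infinitely many
   infinite blocks. Fix [x] in [G]. The sequences that vanish off the blocks and
   are, on each block, a scalar multiple of [x] form a closed subspace [Z] of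
   [X(E)]. If [u + z] is in [S], then so is its restriction to each block, hence
   so is that of [z], so the coefficients of [z] vanish: [U + Z] meets [S] only
   in [0]. It is closed, and its dimension is that of the continuum: it embeds
   in a product of sequence spaces over [K], and summing geometrically small
   copies of [x] over an almost disjoint family of sets of blocks gives a
   family indexed by the reals which is linearly independent modulo [S].

   If [I] is infinite, add a fixed nonzero finitely supported [w] (which is in
   [S]) to smaller and smaller multiples of countably many members of such a
   family. The span still avoids [S], but every closed set that contains it
   contains [w]. *)
Require Import Defs.
From mathcomp Require Import ring lra.

Set Implicit Arguments.
Unset Strict Implicit.
Unset Printing Implicit Defensive.

Import Order.TTheory GRing.Theory Num.Theory.

Local Open Scope classical_set_scope.
Local Open Scope ring_scope.

(** * Cardinality of the continuum *)

Section Cardinals.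
Variable R : realType.
Implicit Type b : nat -> bool.

(** Digits 0 and 1 in base 3 leave gaps: all digits after position [n] contribute at most half of
    [3^-1 ^+ n], so distinct digit sequences have distinct sums. *)
Let psum b n : R := \sum_(k < n) (b k)%:R * 3^-1 ^+ k.

Let psumS b n : psum b n.+1 = psum b n + (b n)%:R * 3^-1 ^+ n.
Proof. exact: big_ord_recr. Qed.

(** [3 / 2 * 3^-1 ^+ n] is the tail from position [n] on with all digits 1. Partial sums increase,
    and partial sums plus this tail decrease. *)
Let psum_tail b n d :
  psum b n <= psum b (n + d) /\
  psum b (n + d) + 3 / 2 * 3^-1 ^+ (n + d) <= psum b n + 3 / 2 * 3^-1 ^+ n.
Proof.
elim: d => [|d [IH1 IH2]]; first by rewrite addn0; split.
rewrite addnS psumS exprS.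
have : 0 <= 3^-1 ^+ (n + d) :> R by rewrite exprn_ge0 ?invr_ge0.
move: (3^-1 ^+ (n + d)) (3^-1 ^+ n) IH1 IH2 => t u.
by case: (b (n + d)) => /= IH1 IH2 t0; split; lra.
Qed.

Let psum_le b m n : psum b m <= psum b n + 3 / 2 * 3^-1 ^+ n.
Proof.
have h k : 0 <= 3^-1 ^+ k :> R by rewrite exprn_ge0 ?invr_ge0.
case: (leqP n m) => [/subnKC <-|/ltnW /subnKC <-].
  by have [_] := psum_tail b n (m - n); have := h (n + (m - n))%N; lra.
by have [] := psum_tail b m (n - m); have := h (m + (n - m))%N; lra.
Qed.

Let digits b : R := sup (range (psum b)).

Let digits_ub b n : digits b <= psum b n + 3 / 2 * 3^-1 ^+ n.
Proof.
apply: ge_sup; first by exists (psum b 0), 0%N.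
by move=> _ [m _ <-]; exact: psum_le.
Qed.

Let digits_lb b n : psum b n <= digits b.
Proof.
apply: ub_le_sup; last by exists n.
by exists (psum b 0 + 3 / 2 * 3^-1 ^+ 0) => _ [m _ <-]; exact: psum_le.
Qed.

Let digits_lt b c n : (forall k, (k < n)%N -> b k = c k) -> b n -> ~~ c n ->
  digits c < digits b.
Proof.
move=> bc bn cn; have := digits_lb b n.+1; have := digits_ub c n.+1.
have -> : psum b n.+1 = psum c n + 3^-1 ^+ n.
  rewrite psumS bn mul1r; congr (_ + _).
  by apply: eq_bigr => k _; rewrite bc.
rewrite psumS (negbTE cn) exprS mul0r addr0.
by have : 0 < 3^-1 ^+ n :> R; [rewrite exprn_gt0 ?invr_gt0|lra].
Qed.

Lemma boolseq_inj_real : exists g : (nat -> bool) -> R, injective g.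
Proof.
exists digits => b c e; apply: contrapT => ne.
have ex : exists n, b n != c n.
  apply: contrapT => h; apply: ne; apply/funext => n.
  by apply: contrapT => /eqP ?; apply: h; exists n.
case: (ex_minnP ex) => n bcn mn.
have eqlt k : (k < n)%N -> b k = c k.
  by move=> kn; apply/eqP; apply: contraTT kn => /mn; rewrite -leqNgt.
move: bcn; case Eb : (b n); case Ec : (c n) => // _.
  by have := @digits_lt b c n eqlt Eb (negbT Ec); rewrite e ltxx.
have := @digits_lt c b n (fun k kn => esym (eqlt k kn)) Ec (negbT Eb).
by rewrite e ltxx.
Qed.

(** Dedekind cuts: a real is determined by the set of rationals below it. *)
Lemma real_inj_boolseq : exists g : R -> nat -> bool, injective g.
Proof.
exists (fun r k => if unpickle k is Some q then ratr q < r else false).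
have lt_neq (x y : R) : x < y ->
    (fun k => if unpickle k is Some q then ratr q < x else false) <>
    (fun k => if unpickle k is Some q then ratr q < y else false).
  move=> /rat_in_itvoo[q]; rewrite in_itv /= => /andP[xq qy].
  move=> /(congr1 (fun h => h (pickle q))); rewrite pickleK qy.
  by rewrite ltNge (ltW xq).
by move=> x y; case: (ltgtP x y) => // [/lt_neq//|/lt_neq h /esym/h].
Qed.

End Cardinals.

Lemma seq_inj_boolseq (T : Type) (g : T -> nat -> bool) : injective g ->
  exists h : (nat -> T) -> nat -> bool, injective h.
Proof.
move=> gi.
exists (fun s k => if unpickle k is Some ij then g (s ij.1) ij.2 else false).
move=> s t st; apply/funext => i; apply: gi; apply/funext => j.
by move/(congr1 (fun h => h (pickle (i, j)))): st; rewrite pickleK.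
Qed.

Lemma pair_inj_boolseq (S T : Type) (g : S -> nat -> bool)
    (h : T -> nat -> bool) : injective g -> injective h ->
  exists k : S * T -> nat -> bool, injective k.
Proof.
move=> gi hi.
exists (fun p n => if odd n then g p.1 n./2 else h p.2 n./2).
move=> [s t] [s' t'] /= e; congr pair.
  apply: gi; apply/funext => n; move/(congr1 (fun f => f n.*2.+1)): e.
  by rewrite /= odd_double /= uphalf_double.
apply: hi; apply/funext => n; move/(congr1 (fun f => f n.*2)): e.
by rewrite odd_double doubleK.
Qed.

Lemma almost_disjoint_family (R : realType) : exists A : R -> nat -> bool,
  forall (s : seq R) (r : R), exists k, A r k /\
    forall t, t \in s -> t != r -> ~~ A t k.
Proof.
(* [A r] codes the pairs [(n, floor (n r))]; for [r <> t] these differ as soon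
   as [n] exceeds [1 / |r - t|]. *)
exists (fun r k => if unpickle k is Some ij
  then ij.2 == Num.floor (ij.1%:R * r) else false : bool).
move=> s r.
have [N HN] : exists N : nat, forall n, (N <= n)%N ->
    forall t, t \in s -> t != r ->
    Num.floor (n%:R * r) != Num.floor (n%:R * t).
  elim: s => [|t s [N HN]]; first by exists 0%N.
  have [->|tr] := eqVneq t r.
    exists N => n Nn t'; rewrite inE => /orP[/eqP->|]; last exact: HN.
    by rewrite eqxx.
  exists (maxn N (Num.truncn `|t - r|^-1).+1) => n.
  rewrite geq_max => /andP[Nn tn] t'; rewrite inE.
  move=> /orP[/eqP-> _|]; last exact: HN.
  apply/eqP => e.
  have d0 : 0 < `|t - r| by rewrite normr_gt0 subr_eq0.
  have : `|t - r|^-1 < n%:R.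
    apply: lt_le_trans (truncnS_gt _) _.
    by rewrite ler_nat.
  rewrite invf_plt ?posrE//; last by rewrite ltr0n; case: (n) tn.
  have n0 : 0 < n%:R :> R by rewrite ltr0n; case: (n) tn.
  rewrite -[n%:R^-1]mul1r ltr_pdivrMr//.
  rewrite ltNge => /negP; apply.
  rewrite -[n%:R]ger0_norm ?ler0n// -normrM mulrC mulrBr.
  have := floor_itv (n%:R * r); have := floor_itv (n%:R * t).
  rewrite -e intrD => /andP[? ?] /andP[? ?].
  by rewrite ler_norml; apply/andP; split; lra.
exists (pickle (N, Num.floor (N%:R * r))); rewrite pickleK /=; split => // t ts tr.
exact: HN.
Qed.

(** * The scalar fields *)

(** The error bounds are taken in the field itself, so that one formulation serves [R] and [R[i]]:
    in [R[i]], [0 < e] forces [e] to be real. *)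
Definition cauchy_complete (K : numDomainType) := forall u : nat -> K,
  (forall e : K, 0 < e -> exists N, forall m n, (N <= m)%N -> (N <= n)%N ->
     `|u m - u n| < e) ->
  exists l, forall e : K, 0 < e ->
    exists N, forall n, (N <= n)%N -> `|u n - l| < e.

Definition archi_pow (K : numFieldType) :=
  forall e : K, 0 < e -> exists n, 2^-1 ^+ n < e.

Section Scalars.
Variable R : realType.
Local Open Scope complex_scope.

Lemma real_archi_pow : archi_pow R.
Proof.
move=> e e0; exists (Num.truncn e^-1).+1.
rewrite exprVn invf_plt ?posrE ?exprn_gt0//.
apply: (lt_trans (truncnS_gt _)).
by rewrite -natrX ltr_nat ltn_expl.
Qed.

Lemma real_cauchy_complete : cauchy_complete R.
Proof.
move=> u hu.
have uc : cauchy (u @ \oo).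
  apply/cauchyP => e e0; have [N HN] := hu e e0.
  by exists (u N); exists N => // n /= Nn; rewrite /ball /=; exact: HN.
exists (lim (u @ \oo)) => e e0.
have ul : u @ \oo --> lim (u @ \oo) by exact: cauchy_cvg.
have [N _ HN] := @cvgr_dist_lt R R nat \oo _ u _ ul e e0.
by exists N => n Nn; rewrite distrC; exact: HN.
Qed.

Lemma complex_archi_pow : archi_pow R[i].
Proof.
move=> e; rewrite ltcE /= => /andP[/eqP ei er].
have [n hn] := real_archi_pow er; exists n.
have -> : 2^-1 ^+ n = (2^-1 ^+ n)%:C :> R[i] by rewrite rmorphXn/= fmorphV rmorph_nat.
by rewrite ltcE /= -ei eqxx.
Qed.

Let norm_complex_le (z : R[i]) :
  `|z| <= (`|complex.Re z| + `|complex.Im z|)%:C.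
Proof.
rewrite normc_def lecR -[leRHS]ger0_norm ?addr_ge0// -sqrtr_sqr ler_wsqrtr//.
rewrite sqrrD !real_normK ?num_real// addrAC lerDl mulrn_wge0//.
by rewrite mulr_ge0.
Qed.

Let norm_Im_le (z : R[i]) : `|complex.Im z|%:C <= `|z|.
Proof. by rewrite normc_def lecR -sqrtr_sqr ler_wsqrtr// lerDr sqr_ge0. Qed.

Lemma complex_cauchy_complete : cauchy_complete R[i].
Proof.
move=> u hu.
have part (p : {additive R[i] -> R}) : (forall z, `|p z|%:C <= `|z|) ->
    exists l, forall e, 0 < e -> exists N, forall n, (N <= n)%N ->
    `|p (u n) - l| < e.
  move=> hp; apply: real_cauchy_complete => e e0.
  have [N HN] := hu e%:C ltac:(by rewrite ltcR).
  exists N => m n Nm Nn; rewrite -ltcR -raddfB.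
  exact: le_lt_trans (hp _) (HN _ _ Nm Nn).
have [a ha] := part (@complex.Re R : {additive R[i] -> R}) (@normc_ge_Re R).
have [b hb] := part (@complex.Im R : {additive R[i] -> R}) norm_Im_le.
exists (a +i* b) => e; rewrite ltcE /= => /andP[/eqP ei er].
have er2 : 0 < complex.Re e / 2 by rewrite divr_gt0.
have [M hM] := ha _ er2; have [N hN] := hb _ er2.
exists (maxn M N) => n; rewrite geq_max => /andP[Mn Nn].
apply: le_lt_trans (norm_complex_le _) _.
rewrite ltcE /= -ei eqxx /= [ltRHS]splitr ltrD//.
  by have := hM n Mn; case: (u n).
by have := hN n Nn; case: (u n).
Qed.

Lemma complex_inj_boolseq : exists g : R[i] -> nat -> bool, injective g.
Proof.
have [h hi] := real_inj_boolseq R.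
have [g gi] := pair_inj_boolseq hi hi.
exists (fun z => g (complex.Re z, complex.Im z)) => x y /gi.
by case: x y => [a b] [c d] /= [-> ->].
Qed.

Variables (K : numFieldType) (hK : real_or_complex R K).

Lemma scalar_archi_pow : archi_pow K.
Proof.
by case: hK => ->; [exact: real_archi_pow|exact: complex_archi_pow].
Qed.

Lemma scalar_cauchy_complete : cauchy_complete K.
Proof.
by case: hK => ->; [exact: real_cauchy_complete|exact: complex_cauchy_complete].
Qed.

Lemma scalar_inj_boolseq : exists g : K -> nat -> bool, injective g.
Proof.
by case: hK => ->; [exact: real_inj_boolseq|exact: complex_inj_boolseq].
Qed.

End Scalars.

(** * Linear algebra *)

Section LinearAlgebra.
Variables (K : numFieldType) (V : lmodType K).
Implicit Types (W B U S : set V) (s : seq V) (a : V -> K).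

Definition subspace W := W 0 /\ forall c u v, W u -> W v -> W (c *: u + v).

Lemma subspaceZ W c u : subspace W -> W u -> W (c *: u).
Proof. by move=> [W0 WL] Wu; rewrite -[_ *: _]addr0; exact: WL. Qed.

Lemma subspaceD W u v : subspace W -> W u -> W v -> W (u + v).
Proof. by move=> [_ WL] Wu Wv; rewrite -[u]scale1r; exact: WL. Qed.

Lemma subspaceB W u v : subspace W -> W u -> W v -> W (u - v).
Proof. by move=> sW Wu Wv; rewrite addrC -scaleN1r; apply: sW.2. Qed.

Lemma subspace_sum (T : eqType) W (s : seq T) (F : T -> V) :
  subspace W -> (forall t, t \in s -> W (F t)) -> W (\sum_(t <- s) F t).
Proof.
move=> sW; elim: s => [|t s IH] h; first by rewrite big_nil; exact: sW.1.
rewrite big_cons; apply: subspaceD => //; first by apply: h; rewrite mem_head.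
by apply: IH => u us; apply: h; rewrite inE us orbT.
Qed.

Lemma subspace_lin_span B : subspace (lin_span B).
Proof.
split; first by exists [::], (fun=> 0); rewrite big_nil.
move=> c _ _ [s [a [sB ->]]] [t [b [tB ->]]].
(* Coefficients depend on the vector, not on its position in the list, so the two lists are merged
   without repetitions and the coefficients of equal entries are summed. *)
exists (undup (s ++ t)),
  (fun v => c * (\sum_(w <- s | w == v) a w) + \sum_(w <- t | w == v) b w).
split=> [v /=|].
  by rewrite mem_undup mem_cat => /orP[/sB|/tB].
have collect (r : seq V) (d : V -> K) : {subset r <= s ++ t} ->
    \sum_(v <- r) d v *: v =
    \sum_(v <- undup (s ++ t)) (\sum_(w <- r | w == v) d w) *: v.
  move=> rst; rewrite big_seq.
  transitivity (\sum_(w <- r) \sum_(v <- undup (s ++ t) | w == v) d w *: v).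
    rewrite [RHS]big_seq; apply: eq_bigr => w wr.
    rewrite (eq_bigl (pred1 w)); last by move=> v; rewrite eq_sym.
    rewrite -big_filter filter_pred1_uniq ?undup_uniq ?mem_undup ?rst//.
    by rewrite big_seq1.
  rewrite (exchange_big_dep xpredT)//=; apply: eq_bigr => v _.
  by rewrite scaler_suml; apply: eq_bigr.
rewrite (collect s a) 1?(collect t b); try by move=> v vs; rewrite mem_cat vs ?orbT.
rewrite scaler_sumr -big_split; apply: eq_bigr => v _ /=.
by rewrite scalerA -scalerDl.
Qed.

Lemma sub_lin_span B : B `<=` lin_span B.
Proof.
move=> v Bv; exists [:: v], (fun=> 1); rewrite big_seq1 scale1r; split => // w /=.
by rewrite inE => /eqP ->.
Qed.

Lemma lin_span_sub B W : subspace W -> B `<=` W -> lin_span B `<=` W.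
Proof.
move=> sW BW _ [s [a [sB ->]]]; apply: subspace_sum => // v vs.
by apply: subspaceZ => //; apply: BW; exact: sB.
Qed.

Lemma lin_span_uniq B u : lin_span B u -> exists s a,
  [/\ uniq s, [set` s] `<=` B & u = \sum_(v <- s) a v *: v].
Proof.
move=> [s [a [sB ->]]].
exists (undup s), (fun v => (count_mem v s)%:R * a v); split => //.
- exact: undup_uniq.
- by move=> v /=; rewrite mem_undup => /sB.
rewrite -big_undup_iterop_count/=; apply: eq_bigr => v _.
by rewrite -scalerA scaler_nat.
Qed.

(** A [w] of [W] outside the span of [B] can be adjoined: in a relation on [B] and [w], a nonzero
    coefficient at [w] would put [w] in the span. *)
Lemma maximal_indep_span B W : subspace W -> B `<=` W -> lin_indep B ->
  (forall w, W w -> lin_indep (B `|` [set w]) -> B w) -> lin_span B = W.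
Proof.
move=> sW BW Bi Bmax; apply/seteqP; split; first exact: lin_span_sub.
move=> w Ww; apply: contrapT => nw; apply: (nw); apply: sub_lin_span.
apply: Bmax => // s a us sB s0.
have sB' v : v \in s -> v != w -> B v.
  by move=> /sB[Bv|/= ->] //; rewrite eqxx.
have [ws|ws] := boolP (w \in s); last first.
  apply: (Bi s a) => // v vs; apply: sB' => //.
  by apply: contraNneq ws => <-.
have aw : a w = 0.
  apply: contrapT => /eqP aw; apply: nw.
  move: s0; rewrite (bigD1_seq w)//= => /eqP; rewrite addr_eq0 => /eqP s0.
  have -> : w = - (a w)^-1 *: \sum_(v <- s | v != w) a v *: v.
    by rewrite scaleNr -scalerN -s0 scalerA mulVf// scale1r.
  apply: subspaceZ (subspace_lin_span B) _.
  exists [seq v <- s | v != w], a; rewrite big_filter; split => // v /=.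
  by rewrite mem_filter => /andP[? ?]; exact: sB'.
move=> v vs; have [->//|vw] := eqVneq v w.
apply: (Bi [seq v <- s | v != w] a).
- exact: filter_uniq.
- by move=> x /=; rewrite mem_filter => /andP[? ?]; exact: sB'.
- by move: s0; rewrite (bigD1_seq w)//= aw scale0r add0r big_filter.
- by rewrite mem_filter vw.
Qed.

Lemma basis_extend B0 W : subspace W -> B0 `<=` W -> lin_indep B0 ->
  exists B, [/\ B0 `<=` B, B `<=` W, lin_indep B & lin_span B = W].
Proof.
move=> sW B0W B0i.
(* [P] speaks of the added part [A] only, so that the empty set, as union of the empty chain,
   satisfies it. *)
pose P A := A `<=` W /\ lin_indep (B0 `|` A).
have [F FP Ftot|A [[AW Ai] Amax]] := @Zorn_bigcup V P.
  split=> [v [A FA Av]|s a us sF]; first exact: (FP A FA).1.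
  (* Independence is tested on finite lists, and a finite list lies in [B0] together with at most
     one member of the chain. *)
  suff [sB|[A FA sA]] : [set` s] `<=` B0 \/
      exists2 A, F A & [set` s] `<=` B0 `|` A.
  - exact: B0i.
  - exact: (FP A FA).2.
  elim: s {us} sF => [|v s IH] sF; first by left.
  have /IH h : [set` s] `<=` B0 `|` \bigcup_(X in F) X.
    by move=> u /= us; apply: sF; rewrite /= inE us orbT.
  have sub C : C v -> [set` s] `<=` C -> [set` v :: s] `<=` C.
    by move=> Cv sC u /=; rewrite inE => /orP[/eqP->//|/sC].
  have [B0v|[A FA Av]] := sF v (mem_head _ _).
    case: h => [h|[A FA h]]; first by left; exact: sub.
    by right; exists A => //; apply: sub => //; left.
  right; case: h => [h|[C FC h]].
    by exists A => //; apply: sub; [right|move=> u /h ?; left].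
  have [AC|CA] := Ftot _ _ FA FC.
    by exists C => //; apply: sub => //; right; exact: AC.
  by exists A => //; apply: sub; [right|move=> u /h [?|/CA ?]; [left|right]].
have B0AW : B0 `|` A `<=` W by move=> v [/B0W|/AW].
exists (B0 `|` A); split => //.
apply: maximal_indep_span => // w Ww wi; apply: contrapT => nw.
apply: (Amax (A `|` [set w])).
  split; first by move=> v; left.
  by move=> /(_ w (or_intror erefl)) Aw; apply: nw; right.
split; first by move=> v [/AW|/= ->].
by rewrite setUA.
Qed.

(* [S = [set 0]] is ordinary linear independence. *)
Definition indep_mod (T : eqType) S (D : set T) (b : T -> V) :=
  forall (s : seq T) (c : T -> K), uniq s -> [set` s] `<=` D ->
    S (\sum_(t <- s) c t *: b t) -> forall t, t \in s -> c t = 0.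

Section IndepMod.
Variables (T : eqType) (S : set V) (D : set T) (b : T -> V).
Hypotheses (sS : subspace S) (bD : indep_mod S D b).

Lemma indep_mod_inj : {in D &, injective b}.
Proof.
move=> t u /set_mem Dt /set_mem Du e; apply: contrapT => /eqP tu.
have /eqP : (if t == t then 1 else -1 : K) = 0; last by rewrite eqxx oner_eq0.
apply: (@bD [:: t; u] (fun x => if x == t then 1 else -1)).
- by rewrite /= inE tu.
- by move=> x /=; rewrite !inE => /orP[] /eqP ->.
- rewrite big_cons big_seq1 eqxx eq_sym (negbTE tu) e scale1r scaleN1r subrr.
  exact: sS.1.
- exact: mem_head.
Qed.

Let preimage_seq s : uniq s -> [set` s] `<=` b @` D ->
  exists r : seq T, [/\ uniq r, [set` r] `<=` D & s = map b r].
Proof.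
elim: s => [|v s IH]; first by exists [::].
move=> /= /andP[vs us] sD.
have [w ws|r [ur rD sr]] := IH us.
  by apply: sD; rewrite /= inE [w \in s]ws orbT.
have [t Dt tv] := sD v (mem_head _ _).
exists (t :: r); rewrite /= ur andbT -tv sr; split => //.
  by apply: contra vs => tr; rewrite sr -tv map_f.
by move=> x /=; rewrite inE => /orP[/eqP->|/rD].
Qed.

Lemma indep_mod_lin_indep : lin_indep (b @` D).
Proof.
move=> s a us sD; have [r [ur rD ->]] := preimage_seq us sD.
rewrite big_map => r0 _ /mapP[t tr ->].
by apply: (bD (c := a \o b) ur rD) => //; rewrite /= r0; exact: sS.1.
Qed.

Lemma indep_mod_card : (b @` D #= D)%card.
Proof. exact: inj_card_eq indep_mod_inj. Qed.

Lemma indep_mod_span : lin_span (b @` D) `&` S `<=` [set 0].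
Proof.
move=> _ [/lin_span_uniq [s [a [us sD ->]]]].
have [r [ur rD ->]] := preimage_seq us sD; rewrite big_map => Sr.
rewrite big_seq big1// => t tr.
have /= -> := bD (c := a \o b) ur rD Sr tr.
by rewrite scale0r.
Qed.

End IndepMod.
End LinearAlgebra.

(** * Limits and quasi-norms *)

Section ScalarLimit.
Variable K : numFieldType.
Hypotheses (Karchi : archi_pow K) (Kcomplete : cauchy_complete K).

Lemma half_pow_le (m n : nat) : (m <= n)%N -> 2^-1 ^+ n <= 2^-1 ^+ m :> K.
Proof. by move=> mn; rewrite ler_wiXn2l// ?invr_ge0// invf_le1 ?ler1n. Qed.

Lemma half_pow_gt0 n : 0 < 2^-1 ^+ n :> K.
Proof. by rewrite exprn_gt0// invr_gt0. Qed.

Lemma eq_norm_lt (E : normedModType K) (x y : E) :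
  (forall e : K, 0 < e -> `|x - y| < e) -> x = y.
Proof.
move=> h; apply/eqP; rewrite -subr_eq0 -normr_eq0; apply: contrapT => /negP n0.
have d0 : 0 < `|x - y| by rewrite lt0r n0 normr_ge0.
by have := h _ d0; rewrite ltxx.
Qed.

(* [P e a] reads: [a] is an approximation with error less than [e]. *)
Lemma approx_limit (P : K -> K -> Prop) (d : K) : 0 < d ->
  (forall e, 0 < e -> exists a, P e a) ->
  (forall e1 e2 a1 a2, P e1 a1 -> P e2 a2 -> `|a1 - a2| * d <= e1 + e2) ->
  exists a, forall e, 0 < e -> exists e' a', [/\ 0 < e', e' < e, P e' a' &
    `|a' - a| < e].
Proof.
move=> d0 Pex Pd.
have [u uP] : {u : nat -> K & forall n, P (2^-1 ^+ n) (u n)}.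
  exact: choice (fun n => Pex _ (half_pow_gt0 n)).
have [e e0|a ha] := Kcomplete (u := u).
  have [N hN] := Karchi (e := e * d / 2) ltac:(by rewrite divr_gt0 ?mulr_gt0).
  exists N => m n Nm Nn; rewrite -(ltr_pM2r d0).
  apply: le_lt_trans (Pd _ _ _ _ (uP m) (uP n)) _.
  by rewrite [ltRHS]splitr ltrD// (le_lt_trans _ hN)// half_pow_le.
exists a => e e0; have [M hM] := ha e e0; have [N hN] := Karchi e0.
exists (2^-1 ^+ (maxn M N)), (u (maxn M N)); split => //.
- exact: half_pow_gt0.
- by apply: le_lt_trans hN; rewrite half_pow_le// leq_maxr.
- by apply: hM; rewrite leq_maxl.
Qed.

(** Where [x i0 != 0], the norm of [x i0] controls the differences of approximate coefficients, so
    these converge; if [x] vanishes, so does [s]. *)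
Lemma proportional_limit (E : normedModType K) (T : Type) (x s : T -> E) :
  (forall e : K, 0 < e -> exists a : K, forall i, `|s i - a *: x i| < e) ->
  exists a : K, forall i, s i = a *: x i.
Proof.
move=> h; have [[i0 xi0]|x0] := pselect (exists i, x i != 0); last first.
  have x0' i : x i = 0 by apply: contrapT => /eqP ?; apply: x0; exists i.
  exists 0 => i; apply: eq_norm_lt => e e0; have [a /(_ i)] := h e e0.
  by rewrite x0' !scaler0.
have d0 : 0 < `|x i0| by rewrite normr_gt0.
have [|a ha] := approx_limit (P := fun e a => forall i, `|s i - a *: x i| < e) d0 h.
  move=> e1 e2 a1 a2 h1 h2; rewrite -normrZ scalerBl.
  have -> : a1 *: x i0 - a2 *: x i0 = (s i0 - a2 *: x i0) - (s i0 - a1 *: x i0).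
    by rewrite opprB [RHS]addrC subrKA.
  apply: le_trans (ler_normB _ _) _; rewrite addrC ltW// ltrD//.
exists a => i; apply: eq_norm_lt => e e0.
have q0 : 0 < 1 + `|x i| by rewrite ltr_pwDl.
have t0 : 0 < e / (1 + `|x i|) by rewrite divr_gt0.
have [e' [a' [e'0 e'e /(_ i) h1 h2]]] := ha _ t0.
have -> : s i - a *: x i = (s i - a' *: x i) + (a' - a) *: x i.
  by rewrite scalerBl addrA subrK.
apply: le_lt_trans (ler_normD _ _) _; rewrite normrZ.
rewrite -[ltRHS](divfK (lt0r_neq0 q0)) mulrDr mulr1.
by rewrite ltr_leD// ?(lt_trans h1)// ler_wpM2r// ltW.
Qed.

End ScalarLimit.

Section QuasiNorm.
Variables (K : numFieldType) (V : quasiBanachType K).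
Hypotheses (Karchi : archi_pow K) (Kcomplete : cauchy_complete K).
Implicit Types (u v w z : V) (W Z : set V).

Lemma qnorm_real v : (qnorm v : K) \is Num.real.
Proof. by rewrite ger0_real// qnorm_ge0. Qed.

Lemma qnorm0 : qnorm (0 : V) = 0 :> K.
Proof. by rewrite -(scale0r (0 : V)) qnormZ normr0 mul0r. Qed.

Lemma qnormN v : qnorm (- v) = qnorm v :> K.
Proof. by rewrite -scaleN1r qnormZ normrN1 mul1r. Qed.

Lemma qnormBC u v : qnorm (u - v) = qnorm (v - u) :> K.
Proof. by rewrite -qnormN opprB. Qed.

Lemma closed_qnormP W : closed W <->
  (forall w, (forall e : K, 0 < e -> exists2 y, W y & qnorm (y - w) < e) -> W w).
Proof.
split=> [Wc w h|h w cw].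
  apply: Wc => A /nbhs_qnorm[e e0 eA]; have [y Wy yw] := h e e0.
  by exists y; split => //; exact: eA.
apply: h => e e0.
have [|y [Wy yw]] := cw [set y | qnorm (y - w) < e].
  by apply/nbhs_qnorm; exists e.
by exists y.
Qed.

(** Each use of the quasi-triangle inequality costs a factor [C]; with ratio [(2 * C)^-1] a tail
    starting at [m] still stays below [2 * C * (r ^+ m * M)]. *)
Lemma summable_geometric : exists2 r : K, 0 < r & forall (v : nat -> V) (M : K),
  (forall k, qnorm (v k) <= r ^+ k * M) ->
  exists l : V, forall e : K, 0 < e -> exists N, forall m, (N <= m)%N ->
    qnorm (\sum_(k < m) v k - l) < e.
Proof.
have [C C1 qD] := @qnormD K V.
have C0 : 0 < C := lt_le_trans ltr01 C1.
exists (2 * C)^-1; first by rewrite invr_gt0 mulr_gt0.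
set r := _^-1 => v M vM.
have r0 : 0 < r by rewrite invr_gt0 mulr_gt0.
have M0 : 0 <= M.
  by apply: le_trans (qnorm_ge0 (v 0)) _; have := vM 0; rewrite expr0 mul1r.
have tail d m : qnorm (\sum_(m <= k < m + d) v k) <= 2 * C * (r ^+ m * M).
  elim: d m => [|d IH] m.
    by rewrite addn0 big_geq// qnorm0 !mulr_ge0 ?exprn_ge0// ltW.
  rewrite big_ltn ?ltnS ?addnS ?leq_addr//; apply: le_trans (qD _ _) _.
  have := IH m.+1; rewrite addSn => IHm.
  apply: le_trans (ler_wpM2l (ltW C0) (lerD (vM m) IHm)) _.
  have -> : 2 * C * (r ^+ m.+1 * M) = r ^+ m * M.
    by rewrite exprS mulrA mulrA mulfV ?mul1r// mulf_neq0 ?lt0r_neq0.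
  by rewrite (_ : C * (_ + _) = 2 * C * (r ^+ m * M))//; ring.
have rle n : r ^+ n <= 2^-1 ^+ n.
  apply: lerXn2r; rewrite ?nnegrE ?invr_ge0 ?mulr_ge0 ?(ltW r0) ?(ltW C0)//.
  rewrite lef_pV2 ?posrE ?mulr_gt0//.
  by rewrite -[leLHS]mulr1 ler_pM2l.
(* [M + 1] instead of [M], since [M] may be zero. *)
have B0 : 0 < 2 * C * (M + 1) by rewrite !mulr_gt0// ltr_wpDl.
have [e e0|l hl] := @qnorm_complete K V (fun m => \sum_(k < m) v k).
  have [N hN] := Karchi (divr_gt0 e0 B0); exists N.
  have main m n : (N <= m)%N -> (m <= n)%N ->
      qnorm (\sum_(k < m) v k - \sum_(k < n) v k) < e.
    move=> Nm mn; rewrite qnormBC -!(big_mkord xpredT v) (big_cat_nat _ mn)//=.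
    rewrite addrAC subrr add0r -(subnKC mn); apply: le_lt_trans (tail _ _) _.
    rewrite -[ltRHS](divfK (lt0r_neq0 B0)) [ltRHS]mulrC.
    rewrite -[ltRHS]mulrA ltr_pM2l ?mulr_gt0// [ltRHS]mulrC.
    apply: le_lt_trans (ler_wpM2r M0 (le_trans (rle m) (half_pow_le _ Nm))) _.
    apply: le_lt_trans (_ : 2^-1 ^+ N * (M + 1) < _).
      by rewrite ler_pM2l ?half_pow_gt0// lerDl.
    by rewrite ltr_pM2r// ltr_wpDl.
  move=> m n Nm Nn; case: (leqP m n) => [|/ltnW]; first exact: main.
  by rewrite qnormBC; exact: main.
exists l => e e0.
have [|N _ hN] := hl [set y | qnorm (y - l) < e].
  by apply/nbhs_qnorm; exists e.
by exists N.
Qed.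

Definition add_line Z u : set V :=
  [set w | exists2 z, Z z & exists a : K, w = z + a *: u].

Lemma subspace_add_line Z u : subspace Z -> subspace (add_line Z u).
Proof.
move=> sZ; split; first by exists 0; [exact: sZ.1|exists 0; rewrite scale0r addr0].
move=> c _ _ [z Zz [a ->]] [z' Zz' [a' ->]].
exists (c *: z + z'); first exact: sZ.2.
by exists (c * a + a'); rewrite scalerDr scalerDl scalerA addrACA.
Qed.

(** If [u] is not in [Z], it has positive quasi-distance from [Z]. The coefficients of [u] in
    approximations of [w] then converge to some [a], and [w - a *: u] is a limit of points of
    [Z]. *)
Lemma closed_add_line Z u : subspace Z -> closed Z -> closed (add_line Z u).
Proof.
move=> sZ /closed_qnormP cZ; have [C C1 qD] := @qnormD K V.
have C0 : 0 < C := lt_le_trans ltr01 C1.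
apply/closed_qnormP => w hw; have [Zu|nZu] := pselect (Z u).
  exists w; last by exists 0; rewrite scale0r addr0.
  apply: cZ => e /hw [_ [z Zz [a ->]] ?]; exists (z + a *: u) => //.
  by apply: subspaceD => //; exact: subspaceZ.
have [d d0 hd] : exists2 d : K, 0 < d & forall z, Z z -> d <= qnorm (z - u).
  apply: contrapT => h; apply: nZu; apply: cZ => e e0.
  apply: contrapT => h'; apply: h; exists e => // z Zz.
  rewrite real_leNgt ?(gtr0_real e0) ?qnorm_real//; apply/negP => ze.
  by apply: h'; exists z.
pose P (e a : K) := exists2 z, Z z & qnorm (z + a *: u - w) < e.
have hw' e : 0 < e -> exists a, P e a.
  by move=> /hw [_ [z Zz [a ->]] ?]; exists a, z.
have dC : 0 < d / C by rewrite divr_gt0.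
have [|a ha] := approx_limit Karchi Kcomplete dC hw'.
  move=> e1 e2 a1 a2 [z1 Zz1 h1] [z2 Zz2 h2].
  rewrite mulrA ler_pdivrMr// [leRHS]mulrC.
  have [->|a12] := eqVneq a1 a2.
    rewrite subrr normr0 mul0r mulr_ge0 ?(ltW C0)// addr_ge0// ltW//.
      exact: le_lt_trans (qnorm_ge0 _) h1.
    exact: le_lt_trans (qnorm_ge0 _) h2.
  have n0 : a1 - a2 != 0 by rewrite subr_eq0.
  (* Chosen so that [(a1 - a2) *: (z - u)] is, up to sign, the difference of the two approximations
     of [w]. *)
  pose z := (a1 - a2)^-1 *: (z2 - z1).
  have Zz : Z z by apply: subspaceZ => //; exact: subspaceB.
  apply: le_trans (ler_wpM2l (normr_ge0 _) (hd z Zz)) _.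
  rewrite -qnormZ scalerBr scalerA mulfV// scale1r -qnormN.
  have -> : - (z2 - z1 - (a1 - a2) *: u) =
      (z1 + a1 *: u - w) + - (z2 + a2 *: u - w).
    rewrite [in RHS]opprB subrKA [in RHS]opprD [RHS]addrACA -scalerBl.
    by rewrite !opprB addrC.
  apply: le_trans (qD _ _) _; rewrite ler_pM2l// qnormN.
  by rewrite ltW// ltrD.
exists (w - a *: u); last by exists a; rewrite subrK.
apply: cZ => e e0.
have q0 : 0 < C * (1 + qnorm u) by rewrite mulr_gt0// ltr_pwDl// qnorm_ge0.
have [e' [a' [e'0 e'e [z Zz h1] h2]]] := ha _ (divr_gt0 e0 q0).
exists z => //.
have -> : z - (w - a *: u) = (z + a' *: u - w) + (a - a') *: u.
  rewrite [RHS]addrAC scalerBl [a *: u - _]addrC [z + _ + _]addrA.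
  by rewrite addrK opprB addrA.
apply: le_lt_trans (qD _ _) _; rewrite qnormZ distrC.
rewrite -[ltRHS](divfK (lt0r_neq0 q0)) [ltRHS]mulrC -[ltRHS]mulrA ltr_pM2l//.
rewrite mulrDl mul1r ltr_leD// ?(lt_trans h1)//.
by rewrite [leLHS]mulrC ler_wpM2l ?qnorm_ge0// ltW.
Qed.
End QuasiNorm.

(** * Blocks *)

Section AddSeq.
Variables (K : numFieldType) (V : quasiBanachType K).
Hypotheses (Karchi : archi_pow K) (Kcomplete : cauchy_complete K).

(** A chosen decomposition [z + a *: u] encodes a vector by the pair of [a] and the code of [z];
    this serves the upper bound on the dimension. *)
Lemma add_line_inj_boolseq (Z : set V) (u : V) :
  (exists h : K -> nat -> bool, injective h) ->
  (exists g : V -> nat -> bool, {in Z &, injective g}) ->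
  exists g : V -> nat -> bool, {in add_line Z u &, injective g}.
Proof.
move=> [h hi] [g gi].
have [k ki] := pair_inj_boolseq hi (fun (x y : nat -> bool) (e : x = y) => e).
have [c cP] : {c : V -> V * K & forall w, add_line Z u w ->
    Z (c w).1 /\ w = (c w).1 + (c w).2 *: u}.
  apply: (choice (P := fun w d => add_line Z u w -> Z d.1 /\ w = d.1 + d.2 *: u)).
  move=> w; have [[z Zz [a ->]]|nw] := pselect (add_line Z u w).
    by exists (z, a).
  by exists (0, 0).
exists (fun w => k ((c w).2, g (c w).1)) => w w' /set_mem Ww /set_mem Ww' /ki[ea eg].
have [Zw ->] := cP w Ww; have [Zw' ->] := cP w' Ww'.
by rewrite ea (gi _ _ _ _ eg) ?inE.
Qed.

(** The vectors of [s] are adjoined one at a time, carrying along closedness, the coding by 0-1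
    sequences and the decomposition of each element. *)
Lemma closed_add_span (Z : set V) (s : seq V) : subspace Z -> closed Z ->
  (exists h : K -> nat -> bool, injective h) ->
  (exists g : V -> nat -> bool, {in Z &, injective g}) ->
  exists W : set V, [/\ subspace W, closed W, Z `<=` W, [set` s] `<=` W &
    (exists g : V -> nat -> bool, {in W &, injective g}) /\
    forall w, W w -> exists z u, [/\ Z z, lin_span [set` s] u & w = z + u]].
Proof.
move=> sZ cZ hK gZ; elim: s => [|u s [W [sW cW ZW sub [gW dW]]]].
  exists Z; split => //; split=> // w Zw; exists w, 0; rewrite addr0; split => //.
  exact: (subspace_lin_span _).1.
have WW' : W `<=` add_line W u.
  by move=> w Ww; exists w => //; exists 0; rewrite scale0r addr0.
exists (add_line W u); split.
- exact: subspace_add_line.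
- exact: closed_add_line.
- exact: subset_trans WW'.
- move=> v /=; rewrite inE => /orP[/eqP->|/sub/WW'//].
  by exists 0; [exact: sW.1|exists 1; rewrite scale1r add0r].
split; first exact: add_line_inj_boolseq.
move=> _ [w /dW [z [y [Zz sy ->]]] [a ->]].
have sspan := subspace_lin_span [set` u :: s].
exists z, (y + a *: u); split; rewrite ?addrA//; apply: subspaceD => //.
  apply: lin_span_sub sy => // v vs; apply: sub_lin_span.
  by rewrite /= inE [v \in s]vs orbT.
by apply: subspaceZ => //; apply: sub_lin_span; rewrite /= mem_head.
Qed.

End AddSeq.

Definition disjoint_subseqs (p : nat -> nat -> nat) : Prop :=
  (forall k, strictly_increasing (p k)) /\
  forall k i k' i', p k i = p k' i' -> k = k' /\ i = i'.

Lemma strictly_increasing_inj n : strictly_increasing n -> injective n.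
Proof.
move=> ni i j e; case: (ltngtP i j) => // /ni; first by rewrite e ltnn.
by rewrite e ltnn.
Qed.

(** Block [k] consists of the [n (2 ^ k * (2 i + 1))], and [k] is read off as a 2-adic valuation.
    Through [m], membership in a set stable under subsequences passes from [n] to every block. *)
Lemma disjoint_subseqs_within n : strictly_increasing n ->
  exists p, disjoint_subseqs p /\ forall k, exists m, strictly_increasing m /\
    forall i, p k i = n (m i).
Proof.
move=> ni; pose q k i := (2 ^ k * i.*2.+1)%N.
have qi k : strictly_increasing (q k).
  by move=> i j ij; rewrite ltn_pmul2l ?expn_gt0// ltnS ltn_double.
exists (fun k i => n (q k i)); split; last by move=> k; exists (q k).
split; first by move=> k i j ij; exact/ni/qi.
move=> k i k' i' /(strictly_increasing_inj ni) e.
have lq a b : logn 2 (q a b) = a.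
  rewrite lognM ?expn_gt0// pfactorK// logn_coprime ?addn0//.
  by rewrite coprime2n/= odd_double.
have kk : k = k' by rewrite -(lq k i) e lq.
split => //; move: e; rewrite kk => e.
exact: (strictly_increasing_inj (qi k') e).
Qed.

Section Coordinates.
Variables (K : numFieldType) (X : std_seq_class K) (E : completeNormedModType K).
Implicit Types x y z : X E.

Lemma coordL c x y j :
  coord X E (c *: x + y) j = c *: coord X E x j + coord X E y j.
Proof. by rewrite linearP. Qed.

Lemma coord_sum (T : Type) (s : seq T) (c : T -> K) (v : T -> X E) j :
  coord X E (\sum_(t <- s) c t *: v t) j = \sum_(t <- s) c t *: coord X E (v t) j.
Proof.
elim: s => [|t s IH]; first by rewrite !big_nil linear0.
by rewrite !big_cons coordL IH.
Qed.

Lemma coord_qnorm_lt (e : K) : 0 < e -> exists2 d : K, 0 < d & forall x y,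
  qnorm (x - y) < d -> forall j, `|coord X E x j - coord X E y j| < e.
Proof.
move=> e0; have [C C0 hC] := coord_le X E; exists (e / C); first exact: divr_gt0.
move=> x y xy j.
have -> : coord X E x j - coord X E y j = coord X E (x - y) j by rewrite linearB.
by apply: le_lt_trans (hC _ _) _; rewrite mulrC -ltr_pdivlMr.
Qed.

Lemma coord_eq x y : coord X E x =1 coord X E y -> x = y.
Proof. by move=> h; apply: (@coord_inj K X E); exact/funext. Qed.

End Coordinates.

Section Blocks.
Variables (K : numFieldType) (X : std_seq_class K) (E : completeNormedModType K).
Hypotheses (Karchi : archi_pow K) (Kcomplete : cauchy_complete K).
Variables (p : nat -> nat -> nat) (x : X E).
Hypothesis hp : disjoint_subseqs p.

(** Block [k] carries a multiple of the whole of [x], with coordinate [i] of [x] moved to place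
    [p k i]; it is not the restriction of [x] to the block. *)
Definition block_space : set (X E) := [set z |
  (forall j, ~ (exists k i, j = p k i) -> coord X E z j = 0) /\
  forall k, exists a : K, forall i, coord X E z (p k i) = a *: coord X E x i].

Lemma subspace_block_space : subspace block_space.
Proof.
split.
  by split=> [j _|k]; [rewrite linear0|exists 0 => i; rewrite linear0 scale0r].
move=> c u v [u0 ua] [v0 va]; split=> [j hj|k].
  by rewrite coordL u0// v0// scaler0 addr0.
have [a ha] := ua k; have [b hb] := va k; exists (c * a + b) => i.
by rewrite coordL ha hb scalerDl scalerA.
Qed.

(** Convergence in [X E] is uniform in the coordinates, and both conditions survive it. *)
Lemma closed_block_space : closed block_space.
Proof.
apply/closed_qnormP => w hw.
have {}hw (e : K) : 0 < e -> exists2 y, block_space y &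
    forall j, `|coord X E w j - coord X E y j| < e.
  move=> /(coord_qnorm_lt X E) [d d0 hd]; have [y Zy yw] := hw d d0; exists y => // j.
  by rewrite distrC; exact: hd.
split=> [j hj|k].
  apply: eq_norm_lt => e /hw [y [y0 _] /(_ j)]; by rewrite y0.
apply: (proportional_limit Karchi Kcomplete) => e /hw[y [_ /(_ k) [a ha]] hy].
by exists a => i; rewrite -ha.
Qed.

Lemma block_space_inj_boolseq : (exists h : K -> nat -> bool, injective h) ->
  exists g : X E -> nat -> bool, {in block_space &, injective g}.
Proof.
move=> [h hi]; have [g gi] := seq_inj_boolseq hi.
have [a aP] : {a : X E -> nat -> K & forall z, block_space z ->
    forall k i, coord X E z (p k i) = a z k *: coord X E x i}.
  apply: (choice (P := fun z (a : nat -> K) => block_space z ->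
    forall k i, coord X E z (p k i) = a k *: coord X E x i)) => z.
  have [[_ /choice[a ha]]|nz] := pselect (block_space z); first by exists a.
  by exists (fun=> 0).
exists (g \o a) => y z /set_mem Zy /set_mem Zz /= /gi e.
apply: coord_eq => j; have [[k [i ->]]|nj] := pselect (exists k i, j = p k i).
  by rewrite aP// aP// e.
by rewrite Zy.1// Zz.1.
Qed.

(** [v] is the sum of [r ^+ k *: y k] over the [k] in [A], where [y k] is [x] spread along block
    [k]. Each [y k] has quasi-norm at most that of [x], so the series converges, with one [r] for
    all [A]. *)
Lemma block_series : exists2 r : K, 0 < r & forall A : nat -> bool,
  exists2 v, block_space v &
    forall k i, coord X E v (p k i) = ((A k)%:R * r ^+ k) *: coord X E x i.
Proof.
have [r r0 rser] := summable_geometric (X E) Karchi.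
exists r => // A.
have [y yP] : {y : nat -> X E & forall k,
    [/\ forall i, coord X E (y k) (p k i) = coord X E x i,
        forall j, ~ range (p k) j -> coord X E (y k) j = 0 &
        qnorm (y k) <= (qnorm x : K)]}.
  apply: (choice (P := fun k y => [/\
        forall i, coord X E y (p k i) = coord X E x i,
        forall j, ~ range (p k) j -> coord X E y j = 0 &
        qnorm y <= (qnorm x : K)])) => k.
  by have [y [y1 y2] y3] := spread_closed x (hp.1 k); exists y; split.
pose c k := (A k)%:R * r ^+ k : K.
have [v hv] : exists l : X E, forall e : K, 0 < e -> exists N, forall m,
    (N <= m)%N -> qnorm (\sum_(k < m) c k *: y k - l) < e.
  apply: (rser (fun k => c k *: y k) (qnorm x)) => k; rewrite qnormZ.
  have rk0 : 0 <= r ^+ k by rewrite exprn_ge0// ltW.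
  apply: ler_pM; rewrite ?qnorm_ge0//; last by have [] := yP k.
  by rewrite /c; case: (A k); rewrite ?mul1r ?mul0r ?normr0// ger0_norm.
(* A coordinate that is eventually constant along the partial sums keeps that value in the limit. *)
have coordv j a N : (forall m, (N <= m)%N ->
    coord X E (\sum_(k < m) c k *: y k) j = a) -> coord X E v j = a.
  move=> ha; apply: eq_norm_lt => e /(coord_qnorm_lt X E) [d d0 hd].
  have [M hM] := hv d d0; rewrite -(ha (maxn M N)) ?leq_maxr// distrC.
  by apply: hd; apply: hM; rewrite leq_maxl.
have coordp k i : coord X E v (p k i) = c k *: coord X E x i.
  apply: (coordv _ _ k.+1) => m km; rewrite coord_sum (bigD1 (Ordinal km))//= big1.
    by have [-> _ _] := yP k; rewrite addr0.
  move=> l lk; have [_ y0 _] := yP l; rewrite y0 ?scaler0// => -[i' _ /hp.2[lk' _]].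
  by move: lk; apply/negP; rewrite negbK; apply/eqP/val_inj.
exists v => //; split; last by move=> k; exists (c k).
move=> j hj; apply: (coordv _ _ 0%N) => m _; rewrite coord_sum big1// => k _.
have [_ y0 _] := yP k; rewrite y0 ?scaler0// => -[i _ ij].
by apply: hj; exists k, i.
Qed.

End Blocks.

(** * Spaceability *)

Section Spaceability.
Variables (R : realType) (K : numFieldType).
Hypothesis hK : real_or_complex R K.
Variables (X : std_seq_class K) (E : completeNormedModType K).
Variable S : set (nat -> E).
Hypotheses (S_sub : subspace S)
  (S_subseq : forall s n, strictly_increasing n -> S s -> S (s \o n))
  (S_detach : forall y : X E, exists2 n, strictly_increasing n &
     S (coord X E y \o n))
  (S_c00 : c00 E `<=` S).

Let Karchi := scalar_archi_pow hK.
Let Kcomplete := scalar_cauchy_complete hK.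

Let SX : set (X E) := [set y | S (coord X E y)].

Let SX_sub : subspace SX.
Proof.
split=> [|c u v Su Sv]; first by rewrite /SX /= linear0; exact: S_sub.1.
by rewrite /SX /= linearP; exact: S_sub.2.
Qed.

(** The vectors are treated in turn: [y] read along the current [n] is again in [X E], so it can be
    detached further, and stability of [S] under subsequences keeps the earlier vectors detached. *)
Lemma common_detach (s : seq (X E)) : exists2 n, strictly_increasing n &
  forall y, y \in s -> S (coord X E y \o n).
Proof.
elim: s => [|y s [n ni hn]]; first by exists id.
have [z zy _] := subseq_closed y ni.
have [m mi Sz] := S_detach z.
exists (n \o m) => [i j ij|u]; first exact/ni/mi.
rewrite inE => /orP[/eqP ->|/hn Su]; last exact: S_subseq mi Su.
by rewrite (_ : _ \o _ = coord X E z \o m)//; apply/funext => i /=; rewrite zy.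
Qed.

(** Along block [k], both [z + u] and [u] lie in [S], and their difference is [a *: x]; a nonzero
    [a] would put [x] in [S]. *)
Lemma block_space_avoids (p : nat -> nat -> nat) (x z u : X E) :
  disjoint_subseqs p -> ~ S (coord X E x) ->
  block_space p x z -> (forall k, S (coord X E u \o p k)) ->
  SX (z + u) -> z = 0.
Proof.
move=> hp nx [z0 za] Su Szu; apply: coord_eq => j; rewrite linear0.
have [[k [i ->]]|nj] := pselect (exists k i, j = p k i); last by rewrite z0.
have [a ha] := za k; rewrite ha.
have [->|a0] := eqVneq a 0; first by rewrite scale0r.
exfalso; apply: nx.
have -> : coord X E x = a^-1 *: ((coord X E (z + u) \o p k) -
    (coord X E u \o p k)).
  apply/funext => l.
  rewrite !fctE /=.
  by rewrite -[z]scale1r coordL scale1r addrK ha scalerA mulVf// scale1r.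
apply: subspaceZ => //; apply: subspaceB => //.
by apply: S_subseq => //; exact: hp.1.
Qed.

(** [v r] is the geometric series over the blocks in [A r], for an almost disjoint family [A]. *)
Lemma block_family (p : nat -> nat -> nat) (x : X E) :
  disjoint_subseqs p -> ~ S (coord X E x) ->
  exists v : R -> X E, (forall r, block_space p x (v r)) /\ indep_mod SX setT v.
Proof.
move=> hp nx; have [A hA] := almost_disjoint_family R.
have [q q0 hq] := block_series Karchi x hp.
have [v vP] : {v : R -> X E & forall r, block_space p x (v r) /\
    forall k i, coord X E (v r) (p k i) = ((A r k)%:R * q ^+ k) *: coord X E x i}.
  apply: (choice (P := fun r y => block_space p x y /\
    forall k i, coord X E y (p k i) = ((A r k)%:R * q ^+ k) *: coord X E x i)) => r.
  by have [y Zy hy] := hq (A r); exists y.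
exists v; split=> [r|s c us _ Ss r rs]; first by have [] := vP r.
have Zs : block_space p x (\sum_(t <- s) c t *: v t).
  apply: subspace_sum => [|t ts]; first exact: subspace_block_space.
  by apply: subspaceZ (subspace_block_space p x) _; have [] := vP t.
(* The block space meets [S] only in 0, so a relation modulo [S] is a genuine relation. *)
have s0 : \sum_(t <- s) c t *: v t = 0.
  apply: (block_space_avoids (u := 0) hp nx Zs); last by rewrite addr0.
  by move=> k; rewrite linear0; exact: S_sub.1.
(* On block [k] every other member of the relation vanishes, which isolates [c r]. *)
have [k [Ark nA]] := hA s r.
have [i xi] : exists i, coord X E x i != 0.
  apply: contrapT => h; apply: nx; suff -> : coord X E x = 0 by exact: S_sub.1.
  by apply/funext => i; apply: contrapT => /eqP xi; apply: h; exists i.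
have : coord X E (\sum_(t <- s) c t *: v t) (p k i) = (c r * q ^+ k) *: coord X E x i.
  rewrite coord_sum (bigD1_seq r)//= big1_seq ?addr0 => [|t /andP[tr ts]].
    by have [_ ->] := vP r; rewrite Ark mul1r scalerA.
  by have [_ ->] := vP t; rewrite (negbTE (nA t ts tr)) mul0r scale0r scaler0.
move/esym/eqP; rewrite s0 linear0 scaler_eq0 (negbTE xi) orbF mulf_eq0.
by rewrite expf_eq0 (gt_eqF q0) andbF orbF => /eqP.
Qed.

Let outside_span (T : eqType) (D : set T) (b : T -> X E) :
  indep_mod SX D b -> lin_span (b @` D) `<=` ~` SX `|` [set 0].
Proof.
move=> bD u uB; have [Su|] := pselect (SX u); last by left.
by right; exact: (indep_mod_span bD).
Qed.

(** [W] is the span of [B] plus a block space whose blocks lie in an index set along which all of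
    [B] is detached. *)
Lemma extend_finite_subspace (B : set (X E)) (x : X E) : ~ SX x ->
  finite_set B -> lin_span B `<=` ~` SX `|` [set 0] ->
  exists W : set (X E), [/\ closed W, subspace_of_dim R W,
    lin_span B `<=` W & W `<=` ~` SX `|` [set 0]].
Proof.
move=> nx /finite_seqP[s ->{B}] sG.
have [n ni hn] := common_detach s.
have [p [hp pn]] := disjoint_subseqs_within ni.
have Sp u : lin_span [set` s] u -> forall k, S (coord X E u \o p k).
  move=> su k; have [m [mi pm]] := pn k.
  have -> : coord X E u \o p k = (coord X E u \o n) \o m.
    by apply/funext => i /=; rewrite pm.
  apply: S_subseq => //; move: u su; apply: lin_span_sub => [|u /hn //].
  split=> [|c u v Su Sv] /=; first by rewrite linear0; exact: S_sub.1.
  by rewrite linearP; exact: S_sub.2.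
have [v [Zv vi]] := block_family hp nx.
have hKb := scalar_inj_boolseq hK.
have [W [sW cW ZW sub [gW dW]]] := closed_add_span Karchi Kcomplete s
  (subspace_block_space p x)
  (closed_block_space Karchi Kcomplete (p := p) (x := x))
  hKb (block_space_inj_boolseq p x hKb).
have [B [vB BW Bi BE]] : exists B,
    [/\ v @` setT `<=` B, B `<=` W, lin_indep B & lin_span B = W].
  apply: basis_extend => //; last exact: indep_mod_lin_indep vi.
  by move=> _ [r _ <-]; apply: ZW.
exists W; split => //.
(* Upper bound: [W], hence its basis, injects into 0-1 sequences and so into [R]. Lower bound: the
   basis contains the family [v]. *)
- exists B; split => //; apply/card_eqPle; split.
    have [g gi] := gW; have [h hi] := boolseq_inj_real R.
    apply: (card_le_trans (subset_card_le BW)); apply/pcard_injP.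
    by exists (h \o g) => y z Wy Wz /hi /gi; exact.
  apply: card_le_trans (subset_card_le vB).
  by have /card_eqPle[] := indep_mod_card SX_sub vi.
- exact: lin_span_sub.
move=> w Ww; have [Sw|] := pselect (SX w); last by left.
right; have [z [u [Zz su wzu]]] := dW w Ww.
have z0 : z = 0.
  by apply: (block_space_avoids hp nx Zz (Sp u su)); rewrite -wzu.
move: Sw; rewrite wzu z0 add0r => Su.
by have [|] := sG u su.
Qed.

(** [g] injects the naturals into [D]. The vector of index [g k] is [w] plus a multiple of [v (g k)]
    of quasi-norm below [2^-1 ^+ k], so the nonzero [w] of [S] is adherent to the span. *)
Lemma infinite_not_spaceable (I : Type) (D : set R) (x : X E) : ~ SX x ->
  infinite_set D -> (D #= [set: I])%card ->
  exists U : set (X E), [/\ subspace_of_dim I U, U `<=` ~` SX `|` [set 0] &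
    forall W : set (X E), closed W -> U `<=` W -> ~ (W `<=` ~` SX `|` [set 0])].
Proof.
move=> nx /infiniteP /pcard_leP[g] DI.
have [p [hp _]] := @disjoint_subseqs_within id (fun i j ij => ij).
have [v [Zv vi]] := block_family hp nx.
have [i xi] : exists i, coord X E x i != 0.
  apply: contrapT => h; apply: nx; rewrite /SX /=.
  suff -> : coord X E x = 0 by exact: S_sub.1.
  by apply/funext => i; apply: contrapT => /eqP xi; apply: h; exists i.
(* A nonzero entry of [x] supplies the nonzero vector of [E] from which [w] is built. *)
pose d : nat -> E := fun j => if j == 0%N then coord X E x i else 0.
have dc : c00 E d by exists 1%N; case.
have [w _ wd] := c00_sub X dc.
have Sw : SX w by rewrite /SX /= wd; exact: S_c00.
have w0 : w <> 0.
  move=> w0; move: wd; rewrite w0 linear0 => /(congr1 (fun f => f 0%N)).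
  by rewrite /d /= => /esym/eqP; rewrite (negbTE xi).
(* [(e r).1] rescales [v r] and [(e r).2] switches [w] on; off the range of [g] the pair is
   [(1, 0)]. *)
have [e eP] : {e : R -> K * K & forall r, (e r).1 != 0 /\ forall k, r = g k ->
    (e r).2 = 1 /\ qnorm ((e r).1 *: v r) < 2^-1 ^+ k}.
  apply: (choice (P := fun r (e : K * K) => e.1 != 0 /\ forall k, r = g k ->
    e.2 = 1 /\ qnorm (e.1 *: v r) < 2^-1 ^+ k)) => r.
  have [[k rk]|nr] := pselect (exists k, r = g k); last first.
    by exists (1, 0); split=> [|k rk]; [exact: oner_neq0|case: nr; exists k].
  have q0 : 0 < 1 + qnorm (v r) by rewrite ltr_pwDl// qnorm_ge0.
  exists (2^-1 ^+ k / (1 + qnorm (v r)), 1); split=> [|k'] /=.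
    by rewrite mulf_neq0 ?invr_eq0 ?lt0r_neq0// half_pow_gt0.
  rewrite rk => /inj; rewrite !inE => /(_ Logic.I Logic.I) <-; split => //.
  rewrite -rk qnormZ ger0_norm ?divr_ge0 ?(ltW q0) ?ltW ?half_pow_gt0//.
  rewrite mulrAC ltr_pdivrMr// ltr_pM2l ?half_pow_gt0//.
  by rewrite ltrDr.
pose b r := (e r).1 *: v r + (e r).2 *: w.
have bi : indep_mod SX D b.
  move=> s c us _ Ss r rs.
  (* Since [w] lies in [S], dropping its multiples turns the relation into one between the [v t]
     modulo [S]. *)
  have /(_ _ rs)/eqP : forall r, r \in s -> c r * (e r).1 = 0.
    apply: vi => //.
    have -> : \sum_(t <- s) (c t * (e t).1) *: v t =
        \sum_(t <- s) c t *: b t - \sum_(t <- s) (c t * (e t).2) *: w.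
      rewrite -sumrB; apply: eq_bigr => t _.
      by rewrite scalerDr !scalerA addrK.
    apply: subspaceB => //; apply: subspace_sum => // t _; exact: subspaceZ.
  by rewrite mulf_eq0 (negbTE (eP r).1) orbF => /eqP.
exists (lin_span (b @` D)); split.
- exists (b @` D); split => //; first exact: indep_mod_lin_indep bi.
  exact: card_eq_trans (indep_mod_card SX_sub bi) DI.
- exact: outside_span.
move=> W /closed_qnormP cW UW WG.
have Ww : W w.
  apply: cW => q q0; have [k hk] := Karchi q0; exists (b (g k)).
    by apply/UW/sub_lin_span; exists (g k) => //; exact: funS.
  have [_ /(_ k erefl)[e2 e1]] := eP (g k).
  by rewrite /b e2 scale1r addrK (lt_trans e1).
by have [|] := WG w Ww.
Qed.

(** [I] is exchanged for a set [D] of reals of the same size, so that real-indexed families restrict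
    to it. An infinite [I] fails the extension half of spaceability. *)
Theorem spaceable_iff_finite (I : Type) (x : X E) : ~ SX x ->
  ([set: I] #<= [set: R])%card ->
  spaceable I R (~` SX) <-> card_lt [set: I] [set: nat].
Proof.
move=> nx /card_subP[D DI _]; split=> [[_ ext]|[In nIn]].
  have Ifin : finite_set [set: I].
    apply: contrapT => Iinf.
    have Dinf : infinite_set D by rewrite (eq_finite_set DI).
    have [U [dU UG UW]] := infinite_not_spaceable nx Dinf DI.
    have [W [cW _ UW' WG]] := ext U dU UG.
    exact: UW cW UW' WG.
  split; first exact: finite_set_countable.
  by move=> /eq_finite_set e; apply: infinite_nat; rewrite -e.
have Ifin : finite_set [set: I].
  apply: contrapT => /infiniteP nI; apply: nIn.
  by apply/card_eqPle.
split=> [|U [B [Bi <- BI]] UG]; last first.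
  by apply: (extend_finite_subspace nx) => //; rewrite (eq_finite_set BI).
have [p [hp _]] := @disjoint_subseqs_within id (fun i j ij => ij).
have [v [_ vi]] := block_family hp nx.
have bi : indep_mod SX D v by move=> s c us _; exact: vi.
exists (lin_span (v @` D)); split; last exact: outside_span.
exists (v @` D); split => //; first exact: indep_mod_lin_indep bi.
exact: card_eq_trans (indep_mod_card SX_sub bi) DI.
Qed.

End Spaceability.

(** * The union of a nested family of sequence classes *)

Section UnionClass.
Variables (K : numFieldType) (E F : completeNormedModType K).
Variables (L : Type) (Y : L -> std_seq_class K) (f : E -> F).
Hypotheses (hL : [set: L] !=set0) (hY : nested F Y)
  (hf : forall l : L, linearly_compatible f (Y l)).

Definition union_preimage : set (nat -> E) :=
  [set s | (\bigcup_l seqs (Y l) F) (fun j => f (s j))].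

Lemma union_preimage_c00 : c00 E `<=` union_preimage.
Proof.
have [l _] := hL; move=> s [N sN]; exists l => //.
by apply: c00_sub; exists N => j /sN ->; have [] := hf l.
Qed.

(** Nestedness puts the images of [u] and [v] in one class, where linear compatibility applies. *)
Lemma union_preimage_subspace : subspace union_preimage.
Proof.
split=> [|c u v [l1 _ Su] [l2 _ Sv]].
  by apply: union_preimage_c00; exists 0%N.
have [l Slu Slv] : exists2 l, seqs (Y l) F (fun j => f (u j)) &
    seqs (Y l) F (fun j => f (v j)).
  by have [/(_ _ Su)|/(_ _ Sv)] := hY l1 l2; [exists l2|exists l1].
have [f0 fZ fD] := hf l; exists l => //; apply: (fD (c *: u)) => //.
have [->|c0] := eqVneq c 0.
  by apply: c00_sub; exists 0%N => j _; rewrite scale0r.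
(* Compatibility speaks of non-membership: used for [c *: u] and the scalar [c^-1], it would expel
   the image of [u] from the class. *)
apply: contrapT => nS; apply: (fZ (c *: u) c^-1 _ nS); first by rewrite invr_eq0.
rewrite (_ : (fun j => _) = fun j => f (u j))//; apply/funext => j.
by rewrite fctE scalerA mulVf// scale1r.
Qed.

Lemma union_preimage_subseq s n :
  strictly_increasing n -> union_preimage s -> union_preimage (s \o n).
Proof.
move=> ni [l _ [y _ ys]]; exists l => //; have [z zy _] := subseq_closed y ni.
by exists z => //; apply/funext => k; rewrite zy ys.
Qed.

(** Any one class of the family will do: either the image of [y] already lies in it, or [y] is
    detachable for it. *)
Lemma union_preimage_detach (X : std_seq_class K) :
  (forall l : L, detachable X f (Y l)) ->
  forall y : X E, exists2 n, strictly_increasing n &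
    union_preimage (coord X E y \o n).
Proof.
move=> hdet y; have [l _] := hL.
have [Sy|nSy] := pselect (seqs (Y l) F (fun j => f (coord X E y j))).
  by exists id => //; exists l.
by have [N [n [_ _ ni _ Sn]]] := hdet l y nSy; exists n => //; exists l.
Qed.

End UnionClass.

Theorem theorem3p2 (R : realType) (hCH : continuum_hypothesis R)
    (K : numFieldType) (hK : real_or_complex R K)
    (E F : completeNormedModType K) (X : std_seq_class K)
    (L : Type) (hL : [set: L] !=set0) (Y : L -> std_seq_class K)
    (hY : nested F Y) (f : E -> F)
    (hf : forall l : L, linearly_compatible f (Y l))
    (hdet : forall l : L, detachable X f (Y l))
    (hG : G_set X f (\bigcup_l seqs (Y l) F) !=set0)
    (I : Type) (hI : ([set: I] #<= [set: R])%card) :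
  spaceable I R (G_set X f (\bigcup_l seqs (Y l) F)) <->
  card_lt [set: I] [set: nat].
Proof.
have [x nx] := hG.
exact: (spaceable_iff_finite hK (union_preimage_subspace hL hY hf)
  (union_preimage_subseq (f := f)) (union_preimage_detach hL hdet)
  (union_preimage_c00 hL hf) nx hI).
Qed.
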